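(* There exists at least one van Rees loop of order $27$ whose left, middle and right nuclei are all trivial.
   Context: A loop is a set with a binary operation whose left translations $y\mapsto xy$ and right translations $y\mapsto yx$ are all bijections and which has a two-sided neutral element $\varepsilon$. Loops $(Q,\cdot)$ and $(P,\circ)$ are isotopic if there are bijections $\alpha,\beta,\gamma:Q\to P$ with $\alpha(x)\circ\beta(y)=\gamma(x\cdot y)$ for all $x,y$. A loop has exponent $3$ if it satisfies $xx\cdot x=x\cdot xx=\varepsilon$ for all $x$. A van Rees loop is a loop $Q$ such that every loop isotopic to $Q$ has exponent $3$. The left, middle and right nuclei of a loop $Q$ are $N_{\lambda}(Q)=\{a\in Q: (ax)y=a(xy)\ \forall x,y\in Q\}$, $N_{\mu}(Q)=\{a\in Q: (xa)y=x(ay)\ \forall x,y\in Q\}$, $N_{\rho}(Q)=\{a\in Q: (xy)a=x(ya)\ \forall x,y\in Q\}$; a nucleus is trivial if it equals $\{\varepsilon\}$. *)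

(* Defs.v *)
From HB Require Import structures.
From mathcomp Require Import all_boot.

Set Implicit Arguments.
Unset Strict Implicit.
Unset Printing Implicit Defensive.

Import Algebra.

Local Open Scope group_scope.

(* The library attaches the unit laws to [UMagma], which requires a            *)
(* [choiceType]; building on [BaseUMagma] allows loops on an arbitrary type.   *)
HB.mixin Record BaseUMagma_isLoop G of BaseUMagma G := {
  loop_mul1x : left_id (1 : G) mul;
  loop_mulx1 : right_id (1 : G) mul;
  loop_lmul_bij : forall x : G, bijective (fun y : G => x * y);
  loop_rmul_bij : forall x : G, bijective (fun y : G => y * x)
}.

#[short(type="loopType")]
HB.structure Definition Loop := {G of BaseUMagma_isLoop G & BaseUMagma G}.

#[short(type="finLoopType")]
HB.structure Definition FinLoop := {G of Loop G & Finite G}.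

Definition isotopic (Q P : loopType) : Prop :=
  exists alpha beta gamma : Q -> P,
    [/\ bijective alpha, bijective beta, bijective gamma
      & forall x y : Q, alpha x * beta y = gamma (x * y)].

Definition has_exponent3 (Q : loopType) : Prop :=
  forall x : Q, (x * x) * x = 1 /\ x * (x * x) = 1.

Definition van_Rees (Q : loopType) : Prop :=
  forall P : loopType, isotopic Q P -> has_exponent3 P.

Definition left_nucleus (Q : loopType) (a : Q) : Prop :=
  forall x y : Q, (a * x) * y = a * (x * y).

Definition middle_nucleus (Q : loopType) (a : Q) : Prop :=
  forall x y : Q, (x * a) * y = x * (a * y).

Definition right_nucleus (Q : loopType) (a : Q) : Prop :=
  forall x y : Q, (x * y) * a = x * (y * a).

Definition trivial_nucleus (Q : loopType) (N : Q -> Prop) : Prop :=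
  forall a : Q, N a <-> a = 1.

(* Main.v *)
(** Let t be a root of t^2 = t + 1 in the field F_9.  On Z_3 x F_9 put
      (i, x)(j, y) = (i + j, t^p_ij x + t^q_ij y)
    for suitable exponents p_ij and q_ij.  Every isotope of a loop has exponent 3
    as soon as, writing s = ab, the equations xb = ay = u, xy = wb = v imply
    wy = s, and dually xb = ay = u, az = xy = v imply xz = s: these say that two
    cells of the Cayley table lying on a common line generate a Latin subsquare of
    order 3.  Here both implications, and the failure of every a <> 1 to lie in a
    nucleus, are finite checks. *)

Require Import Defs.
From HB Require Import structures.
From mathcomp Require Import all_boot.
From mathcomp Require ssralg zmodp.

Set Implicit Arguments.
Unset Strict Implicit.
Unset Printing Implicit Defensive.

Section ExponentThreeIsotopes.
Local Open Scope group_scope.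

(* With 1 = alpha a * beta b, an element alpha x = beta y of an isotope is
   u = gamma (x * b) = gamma (a * y), and its square is gamma (x * y). *)
Lemma van_Rees_criterion (Q : loopType) :
  (forall a b x y w : Q, x * b = a * y -> w * b = x * y -> w * y = a * b) ->
  (forall a b x y z : Q, x * b = a * y -> a * z = x * y -> x * z = a * b) ->
  van_Rees Q.
Proof.
move=> critl critr P [al [be [ga [[al' _ alK'] [be' _ be'K] gabij morph]]]] u.
have ga_inj := bij_inj gabij.
set a := al' 1; set b := be' 1; set x := al' u; set y := be' u.
have [ala alx] : al a = 1 /\ al x = u by rewrite !alK'.
have [beb bey] : be b = 1 /\ be y = u by rewrite !be'K.
have xb_ay : x * b = a * y.
  by apply: ga_inj; rewrite -!morph alx beb ala bey loop_mulx1 loop_mul1x.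
have ga_ab : ga (a * b) = 1 by rewrite -morph ala beb loop_mulx1.
have ga_xy : ga (x * y) = u * u by rewrite -morph alx bey.
have alw := alK' (u * u); have bez := be'K (u * u).
split.
(* Put [w := al' (u * u)]: then (uu)u is [ga (w * y)], so [critl] turns it into [ga (a * b)], the
   unit of [P]. *)
- rewrite -alw -[X in _ * X = _]bey morph (critl a b x) //.
  by apply: ga_inj; rewrite -morph alw beb loop_mulx1 ga_xy.
- rewrite -bez -[X in X * _ = _]alx morph (critr a b x y) //.
  by apply: ga_inj; rewrite -morph bez ala loop_mul1x ga_xy.
Qed.

End ExponentThreeIsotopes.

Module Z3F9.
Import ssralg zmodp GRing.Theory.
Local Open Scope ring_scope.

Definition T : Type := 'Z_3 * ('Z_3 * 'Z_3).
HB.instance Definition _ := Finite.on T.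

(* The pair (a, b) stands for a t + b. *)
Definition mult (v : 'Z_3 * 'Z_3) : 'Z_3 * 'Z_3 := (v.1 + v.2, v.1).
Definition mulexp (n : nat) v := iter n mult v.

(** The zeros in the first column of [p] and the first row of [q] make [0] neutral. *)
Definition p (i j : 'Z_3) : nat :=
  nth 0%N (nth [::] [:: [:: 0; 7; 5]; [:: 0; 0; 0]; [:: 0; 1; 3]]%N i) j.
Definition q (i j : 'Z_3) : nat :=
  nth 0%N (nth [::] [:: [:: 0; 0; 0]; [:: 0; 0; 0]; [:: 5; 1; 2]]%N i) j.

Definition op (x y : T) : T :=
  (x.1 + y.1, mulexp (p x.1 y.1) x.2 + mulexp (q x.1 y.1) y.2).

(* t has order 8, so t^(7 n) inverts t^n. *)
Definition ldiv (x z : T) : T :=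
  let j := z.1 - x.1 in
  (j, mulexp (7 * q x.1 j) (z.2 - mulexp (p x.1 j) x.2)).
Definition rdiv (z y : T) : T :=
  let i := z.1 - y.1 in
  (i, mulexp (7 * p i y.1) (z.2 - mulexp (q i y.1) y.2)).

(** An explicit list, so that [vm_compute] can evaluate the exhaustive checks. *)
Definition elems : seq T :=
  let e : seq 'Z_3 := [:: 0; 1; -1] in
  [seq (i, v) | i <- e, v <- [seq (a, b) | a <- e, b <- e]].

Lemma mem_elems x : x \in elems.
Proof.
case: x => i [a b]; case: i => [[|[|[|?]]] ?] //; case: a => [[|[|[|?]]] ?] //;
  by case: b => [[|[|[|?]]] ?].
Qed.

Lemma all_elems (P : pred T) : all P elems -> forall x, P x.
Proof. by move=> /allP Pall x; apply: Pall (mem_elems x). Qed.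

Lemma all2_elems (P : rel T) :
  all (fun x => all (P x) elems) elems -> forall x y, P x y.
Proof. by move=> Pall x; apply/all_elems; apply: (all_elems Pall x). Qed.

Lemma all3_elems (P : T -> rel T) :
  all (fun x => all (fun y => all (P x y) elems) elems) elems ->
  forall x y z, P x y z.
Proof. by move=> Pall x; apply/all2_elems; apply: (all_elems Pall x). Qed.

Lemma op0x : left_id (0 : T) op.
Proof. by move=> x; apply/eqP; move: x; apply: all_elems; vm_compute. Qed.

Lemma opx0 : right_id (0 : T) op.
Proof. by move=> x; apply/eqP; move: x; apply: all_elems; vm_compute. Qed.

Lemma opKl x : cancel (op x) (ldiv x).
Proof. by move=> y; apply/eqP; move: x y; apply: all2_elems; vm_compute. Qed.

Lemma ldivK x : cancel (ldiv x) (op x).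
Proof. by move=> y; apply/eqP; move: x y; apply: all2_elems; vm_compute. Qed.

Lemma opKr x : cancel (op^~ x) (rdiv^~ x).
Proof. by move=> y; apply/eqP; move: x y; apply: all2_elems; vm_compute. Qed.

Lemma rdivK x : cancel (rdiv^~ x) (op^~ x).
Proof. by move=> y; apply/eqP; move: x y; apply: all2_elems; vm_compute. Qed.

(** The first implication of the criterion, its premises solved for [w] and [a]: an identity left to
    test on all 27^3 triples. The next lemma is the dual, solved for z and [b]. *)
Lemma op_subsquarel b x y : op (rdiv (op x y) b) y = op (rdiv (op x b) y) b.
Proof. by apply/eqP; move: b x y; apply: all3_elems; vm_compute. Qed.

Lemma op_subsquarer a x y : op x (ldiv a (op x y)) = op a (ldiv x (op a y)).
Proof. by apply/eqP; move: a x y; apply: all3_elems; vm_compute. Qed.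

(** Reduces failure of an identity to a boolean search for a witness pair, so that one computation
    treats all [a != 0]. *)
Lemma has_elems_neq (F G : T -> T -> T) :
  has (fun x => has (fun y => F x y != G x y) elems) elems ->
  ~ (forall x y, F x y = G x y).
Proof.
by move=> /hasP[x _ /hasP[y _ /eqP neqFG]] eqFG; apply: neqFG; apply: eqFG.
Qed.

Lemma op_not_assocl a :
  a != 0 -> ~ (forall x y, op (op a x) y = op a (op x y)).
Proof.
move=> a0; apply: has_elems_neq; apply/implyP: a0; move: a.
by apply: all_elems; vm_compute.
Qed.

Lemma op_not_assocm a :
  a != 0 -> ~ (forall x y, op (op x a) y = op x (op a y)).
Proof.
move=> a0; apply: has_elems_neq; apply/implyP: a0; move: a.
by apply: all_elems; vm_compute.
Qed.

Lemma op_not_assocr a :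
  a != 0 -> ~ (forall x y, op (op x y) a = op x (op y a)).
Proof.
move=> a0; apply: has_elems_neq; apply/implyP: a0; move: a.
by apply: all_elems; vm_compute.
Qed.

Lemma card_T : #|{: T}| = 27%N.
Proof. by rewrite !card_prod !card_ord. Qed.

HB.instance Definition _ := hasMul.Build T op.
HB.instance Definition _ := hasOne.Build T 0.
HB.instance Definition _ := BaseUMagma_isLoop.Build T op0x opx0
  (fun x => Bijective (opKl x) (ldivK x))
  (fun x => Bijective (opKr x) (rdivK x)).

Lemma T_van_Rees : van_Rees T.
Proof.
apply: van_Rees_criterion => a b x y w xb_ay.
- move=> wb_xy.
  have -> : w = rdiv (op x y) b.
    (* [op x y] is restated as the loop product, the form in which the hypothesis can rewrite it. *)
    by rewrite -[RHS]/(rdiv (x * y)%g b) -wb_xy opKr.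
  have -> : a = rdiv (op x b) y.
    by rewrite -[RHS]/(rdiv (x * b)%g y) xb_ay opKr.
  exact: op_subsquarel.
- move=> az_xy.
  have -> : w = ldiv a (op x y).
    by rewrite -[RHS]/(ldiv a (x * y)%g) -az_xy opKl.
  have -> : b = ldiv x (op a y).
    by rewrite -[RHS]/(ldiv x (a * y)%g) -xb_ay opKl.
  exact: op_subsquarer.
Qed.

End Z3F9.

Import Z3F9.

Theorem mainTheorem7 :
  exists Q : finLoopType,
    [/\ #|Q| = 27,
        van_Rees Q,
        trivial_nucleus (@left_nucleus Q),
        trivial_nucleus (@middle_nucleus Q)
      & trivial_nucleus (@right_nucleus Q)].
Proof.
exists T; split.
- exact: card_T.
- exact: T_van_Rees.
- move=> a; split=> [|->]; last by move=> x y; rewrite !loop_mul1x.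
  (* The unit [1%g] of [T] is [0] by definition, so [a1] has the type that [op_not_assocl]
     expects. *)
  by case: (eqVneq a 1%g) => // a1 /(op_not_assocl a1).
- move=> a; split=> [|->]; last by move=> x y; rewrite loop_mulx1 loop_mul1x.
  by case: (eqVneq a 1%g) => // a1 /(op_not_assocm a1).
- move=> a; split=> [|->]; last by move=> x y; rewrite !loop_mulx1.
  by case: (eqVneq a 1%g) => // a1 /(op_not_assocr a1).
Qed.
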